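(* Let $\kappa>0$, $h>0$, and $B=B(x_0,h)\subset\mathbb{R}^2$. For real angles $\theta_j,\theta_\ell$, the plane waves $\psi_\theta(x)=e^{i\kappa d(\theta)\cdot(x-x_0)}$, $d(\theta)=(\cos\theta,\sin\theta)$, satisfy $$\langle\psi_{\theta_j},\psi_{\theta_\ell}\rangle_{\mathrm{tr}}=\sum_{m\in\mathbb{Z}}\tau_m^2\,e^{-im(\theta_j-\theta_\ell)}.$$ If $q\ge1$ is an integer and $\theta_j=2\pi j/q$ for $j=0,\ldots,q-1$, then the trace Gram matrix $G_q^{\mathrm{PW}}=\big(\langle\psi_{\theta_j},\psi_{\theta_\ell}\rangle_{\mathrm{tr}}\big)_{j,\ell=0}^{q-1}$ is circulant, with eigenvalues (counted with multiplicity) $$\lambda_s=q\sum_{\substack{m\in\mathbb{Z}\\ m\equiv -s\ (\mathrm{mod}\ q)}}\tau_m^2,\qquad s=0,\ldots,q-1.$$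
   Context: The scaled Cauchy trace inner product on the circle $\partial B$ is $$\langle v,w\rangle_{\mathrm{tr}}=\int_{\partial B}\big(\kappa\, v\,\overline{w}+\kappa^{-1}\,\partial_n v\,\overline{\partial_n w}\big)\,ds,$$ with $\partial_n$ the outward normal derivative. The weights are $\tau_m^2=2\pi h\kappa\big(J_m(\kappa h)^2+J_m'(\kappa h)^2\big)$, $m\in\mathbb{Z}$, where $J_m$ is the Bessel function of the first kind. *)

(* Defs.v *)
From mathcomp Require Import all_boot all_order all_algebra finmap complex.
From mathcomp Require Import all_classical all_reals all_analysis.
From mathcomp.analysis.showcase Require summability.

Set Implicit Arguments.
Unset Strict Implicit.
Unset Printing Implicit Defensive.

Import Order.TTheory GRing.Theory Num.Theory numFieldNormedType.Exports.

Local Open Scope classical_set_scope.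
Local Open Scope ring_scope.
Local Open Scope complex_scope.

(* Sums over an arbitrary index set D are unconditional: limits of finite
   partial sums along the directed set of finite subsets.  R[i]^o is R[i] with
   the topology of its complex modulus. *)
Definition csum_partial {R : realType} {I : choiceType} (D : set I)
    (f : I -> R[i]) (A : {fset I}) : R[i]^o :=
  \sum_(m <- A | m \in D) f m.

Definition csummable {R : realType} {I : choiceType} (D : set I)
    (f : I -> R[i]) : Prop :=
  cvg (csum_partial D f A @[A --> @summability.totally I]).

Definition csum {R : realType} {I : choiceType} (D : set I)
    (f : I -> R[i]) : R[i] :=
  lim (csum_partial D f A @[A --> @summability.totally I]).

Section Bessel.
Context {R : realType}.

Definition besselJ_nat (n : nat) (x : R) : R :=
  limn (series (fun k : nat =>
    (-1) ^+ k / (k`! * (k + n)`!)%:R * (x / 2) ^+ (2 * k + n))).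

(* J_(-n) = (-1)^n J_n, and Negz n is -(n.+1). *)
Definition besselJ (m : int) (x : R) : R :=
  match m with
  | Posz n => besselJ_nat n x
  | Negz n => (-1) ^+ n.+1 * besselJ_nat n.+1 x
  end.

(* tau_m squared *)
Definition tau2 (kappa h : R) (m : int) : R :=
  2 * pi * h * kappa *
    (besselJ m (kappa * h) ^+ 2 + derive1 (besselJ m) (kappa * h) ^+ 2).

End Bessel.

Section Trace.
Context {R : realType}.

(* e^(i t) for real t *)
Definition expi (t : R) : R[i] := cos t +i* sin t.

Definition dot2 (u v : 'rV[R]_2) : R := \sum_(i < 2) u 0 i * v 0 i.

Definition dir (theta : R) : 'rV[R]_2 :=
  \row_(i < 2) (if i == 0 then cos theta else sin theta).

(* Integral over the circle of centre x0 and radius h with respect to arc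
   length ds = h dt, real and imaginary parts separately. *)
Definition circle_int (x0 : 'rV[R]_2) (h : R) (f : 'rV[R]_2 -> R[i]) : R[i] :=
  (\int[lebesgue_measure]_(t in `[0%R, (2 * pi)%R])
      (complex.Re (f (x0 + h *: dir t)) * h))%R
  +i*
  (\int[lebesgue_measure]_(t in `[0%R, (2 * pi)%R])
      (complex.Im (f (x0 + h *: dir t)) * h))%R.

(* Derivative at a point y of the circle along the outward unit normal
   (y - x0) / h. *)
Definition normal_derive (x0 : 'rV[R]_2) (h : R) (v : 'rV[R]_2 -> R[i])
    (y : 'rV[R]_2) : R[i] :=
  let n := h^-1 *: (y - x0) in
  'D_n (fun z => complex.Re (v z)) y +i* 'D_n (fun z => complex.Im (v z)) y.

Definition trace_ip (kappa : R) (x0 : 'rV[R]_2) (h : R)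
    (v w : 'rV[R]_2 -> R[i]) : R[i] :=
  circle_int x0 h (fun y =>
    kappa%:C * v y * (w y)^*
    + (kappa^-1)%:C * normal_derive x0 h v y * (normal_derive x0 h w y)^*).

Definition plane_wave (kappa : R) (x0 : 'rV[R]_2) (theta : R)
    (x : 'rV[R]_2) : R[i] :=
  expi (kappa * dot2 (dir theta) (x - x0)).

Definition gram_PW (kappa : R) (x0 : 'rV[R]_2) (h : R) (q : nat) : 'M[R[i]]_q :=
  let psi (j : 'I_q) := plane_wave kappa x0 (2 * pi * j%:R / q%:R) in
  \matrix_(j < q, l < q) trace_ip kappa x0 h (psi j) (psi l).

End Trace.

(* The entry in position (j, l) is c_((l - j) mod q). *)
Definition circulant {T : Type} {q : nat} (A : 'M[T]_q) : Prop :=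
  exists c : nat -> T, forall j l : 'I_q, A j l = c ((l + (q - j)) %% q)%N.

(* s lists the eigenvalues of A with their algebraic multiplicities. *)
Definition eigenvalues_with_mult {F : fieldType} {q : nat} (A : 'M[F]_q)
    (s : seq F) : Prop :=
  char_poly A = \prod_(x <- s) ('X - x%:P).

(* Main.v *)
Require Import Defs.
From mathcomp Require Import all_boot all_order all_algebra finmap complex.
From mathcomp Require Import all_classical all_reals all_analysis.
From mathcomp.analysis.showcase Require summability.
From mathcomp Require Import zify ring lra.

(** On the circle, at the point of angle [t], a plane wave is [e^(i z sin psi)]
    with [z = kappa h] and [psi = t + pi / 2 - theta].  By the Jacobi-Anger
    expansion its Fourier coefficients in [psi] are the Bessel values [J_m(z)],
    and those of its normal derivative are [kappa J_m'(z)].  Two plane waves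
    differ by a rotation, so Parseval's identity turns the two boundary integrals
    into [2 pi sum_m J_m(z)^2 e^(-i m (theta_j - theta_l))] and the same sum with
    [J_m'(z)^2]; together they form the series with weights [tau_m^2].

    Everything analytic is done with real cosines carrying an arbitrary phase, and
    with partial sums over windows [[-N, N]].  [jacobi_anger] is proved without
    multiplying power series: the derivative in [x] of
    [sum_(|m| <= N) J_m(x) cos(m psi - x sin psi + b)] telescopes, because
    [J_m' = (J_(m-1) - J_(m+1)) / 2] ([is_derive_besselJ]), and what is left is a
    few Bessel values of order about [N], which are [O(2^-N)] uniformly in [psi]
    and [b] ([besselJ_le]).  Uniformity lets [parseval] integrate term by term.
    Since [|tau_m^2 e^(i ...)| = tau_m^2] is itself summable,
    [cvg_csum_partial] passes from windows to arbitrary finite sets, which gives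
    [cvg_trace_csum].

    For equispaced angles the Gram entries depend on [l - j] modulo [q], so the
    Fourier matrix diagonalises the Gram matrix ([circulant_eigenvalues]) and the
    eigenvalues are discrete Fourier transforms of its first row.  Summing roots
    of unity over the row turns such a transform into [q] times the sum of
    [tau_m^2] over one residue class ([cvg_csum_residue]). *)

Import Order.TTheory GRing.Theory Num.Theory numFieldNormedType.Exports.

Local Open Scope classical_set_scope.
Local Open Scope ring_scope.
Local Open Scope complex_scope.

#[local] Existing Instance summability.totally_filter.

(** * Bessel functions: derivatives, recurrence and decay in the order *)

Section BesselCalculus.
Context {R : realType}.
Implicit Types (x y z : R) (n k : nat) (m : int).

Lemma scale_selfE (a b : R) : a *: b = a * b. Proof. by []. Qed.

(** The Bessel-Clifford function at [- y].  Its series has no gaps, unlike that of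
    the Bessel function, so that it can be differentiated termwise as a power
    series; [besselJ_natE] recovers [J_n]. *)
Definition clifford_coef n : R^nat := fun k => (-1) ^+ k / (k`! * (k + n)`!)%:R.

Definition clifford n y : R := limn (pseries (clifford_coef n) y).

Lemma clifford_coef_le n k y :
  `|clifford_coef n k * y ^+ k| <= n`!%:R^-1 * exp_coeff `|y| k.
Proof.
have -> : `|clifford_coef n k * y ^+ k| = (k + n)`!%:R^-1 * exp_coeff `|y| k.
  rewrite /clifford_coef /exp_coeff /= !normrM normfV !normrX normrN1 expr1n.
  by rewrite mul1r normr_nat natrM invfM mulrC mulrA mulrC.
rewrite ler_wpM2r ?exp_coeff_ge0//.
by rewrite lef_pV2 ?posrE ?ltr0n ?fact_gt0// ler_nat leq_fact// leq_addl.
Qed.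

Lemma is_cvg_norm_clifford n y :
  cvgn (series (fun k => `|clifford_coef n k * y ^+ k|)).
Proof.
apply: (series_le_cvg _ _ (clifford_coef_le n ^~ y)) => [k|k|]/=.
- exact: normr_ge0.
- by rewrite mulr_ge0 ?invr_ge0// exp_coeff_ge0.
- exact/is_cvg_seriesZ/is_cvg_series_exp_coeff.
Qed.

Lemma is_cvg_clifford n y : cvgn (pseries (clifford_coef n) y).
Proof. exact/normed_cvg/is_cvg_norm_clifford. Qed.

Lemma clifford_le n y : `|clifford n y| <= n`!%:R^-1 * expR `|y|.
Proof.
have nle : `|clifford n y| <= limn (series (fun k => `|clifford_coef n k * y ^+ k|)).
  exact: (@lim_series_norm R R^o _ (is_cvg_norm_clifford n y)).
apply: le_trans nle _.
have -> : n`!%:R^-1 * expR `|y| = limn (series (n`!%:R^-1 *: exp_coeff `|y|)).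
  by rewrite lim_seriesZ//; exact: is_cvg_series_exp_coeff.
apply: lim_series_le (is_cvg_norm_clifford n y) _ (clifford_coef_le n ^~ y).
exact/is_cvg_seriesZ/is_cvg_series_exp_coeff.
Qed.

(** Termwise differentiation only raises the order, which makes the family closed
    under derivatives and all the convergence conditions alike. *)
Lemma pseries_diffs_clifford n :
  pseries_diffs (clifford_coef n) = - clifford_coef n.+1.
Proof.
apply/funext => k; rewrite /pseries_diffs fctE /clifford_coef.
rewrite addSnnS factS exprS !natrM.
have f1 : (k`!%:R : R) != 0 by rewrite pnatr_eq0 -lt0n fact_gt0.
have f2 : ((k + n.+1)`!%:R : R) != 0 by rewrite pnatr_eq0 -lt0n fact_gt0.
have f3 : (k.+1%:R : R) != 0 by rewrite pnatr_eq0.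
by field; rewrite f1 f2 addrC natr1.
Qed.

Lemma pseriesN (c : R^nat) y : pseries (- c) y = - pseries c y.
Proof.
by rewrite /pseries -seriesN; congr series; apply/funext => i; exact: mulNr.
Qed.

Lemma is_derive_clifford n y :
  is_derive y (1 : R) (clifford n) (- clifford n.+1 y).
Proof.
have cN k u : cvgn (pseries (- clifford_coef k) u).
  by rewrite pseriesN; apply: is_cvgN; exact: is_cvg_clifford.
have -> : - clifford n.+1 y = limn (pseries (pseries_diffs (clifford_coef n)) y).
  by rewrite pseries_diffs_clifford pseriesN limN//; exact: is_cvg_clifford.
apply: (@pseries_snd_diffs _ _ (`|y| + 1)).
- exact: is_cvg_clifford.
- by rewrite pseries_diffs_clifford.
- rewrite pseries_diffs_clifford pseries_diffsN pseries_diffs_clifford opprK.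
  exact: is_cvg_clifford.
- by rewrite [ltRHS]ger0_norm ?addr_ge0// ltrDl.
Qed.

(** Coefficientwise, [(k + n + 1) - (n + 1) = k] cancels one factor of [k!], and
    the term [k = 0] disappears, which leaves [y] times a shifted series. *)
Lemma clifford_rec n y :
  clifford n y - n.+1%:R * clifford n.+1 y = - (y * clifford n.+2 y).
Proof.
have c0 := @is_cvg_clifford n y; have c1 := @is_cvg_clifford n.+1 y.
have c2 := @is_cvg_clifford n.+2 y.
pose u k := clifford_coef n k * y ^+ k - n.+1%:R * (clifford_coef n.+1 k * y ^+ k).
have uE : series u @ \oo --> clifford n y - n.+1%:R * clifford n.+1 y.
  have -> : series u = fun N => pseries (clifford_coef n) y N
                     - n.+1%:R * pseries (clifford_coef n.+1) y N.
    by apply/funext => N; rewrite /pseries /series/= mulr_sumr sumrB.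
  by apply: cvgB => //; apply: cvgMr.
have : [sequence series u N.+1]_N @ \oo --> - (y * clifford n.+2 y).
  have -> : [sequence series u N.+1]_N = fun N => - (y * pseries (clifford_coef n.+2) y N).
    apply/funext => N; rewrite /pseries /series/= big_nat_recl//.
    have -> : u 0%N = 0.
      rewrite /u/clifford_coef !expr0 !mulr1 !add0n !fact0 !mul1n factS natrM.
      have f1 : (n`!%:R : R) != 0 by rewrite pnatr_eq0 -lt0n fact_gt0.
      by field; rewrite f1 addrC natr1 pnatr_eq0.
    rewrite add0r mulr_sumr -sumrN; apply: eq_bigr => k _.
    rewrite /u /clifford_coef !exprS.
    have -> : (k + n.+2 = (k + n).+2)%N by rewrite !addnS.
    have -> : (k.+1 + n = (k + n).+1)%N by rewrite addSn.
    have -> : (k.+1 + n.+1 = (k + n).+2)%N by rewrite addSn addnS.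
    rewrite !factS !natrM -!natr1 natrD.
    have f1 : (k`!%:R : R) != 0 by rewrite pnatr_eq0 -lt0n fact_gt0.
    have f2 : ((k + n)`!%:R : R) != 0 by rewrite pnatr_eq0 -lt0n fact_gt0.
    by field; rewrite f1 f2 -natrD !natr1 !pnatr_eq0.
  by apply: cvgN; apply: cvgMr.
by rewrite cvg_shiftS => /(cvg_unique _ uE); exact.
Qed.

Lemma besselJ_natE n x : besselJ_nat n x = (x / 2) ^+ n * clifford n ((x / 2) ^+ 2).
Proof.
rewrite /besselJ_nat; apply/cvg_lim => //.
set s := series _.
have -> : s = fun N => (x / 2) ^+ n * pseries (clifford_coef n) ((x / 2) ^+ 2) N.
  apply/funext => N; rewrite /s /pseries /series/= [RHS]mulr_sumr.
  apply: eq_bigr => k _; rewrite /clifford_coef exprD exprM.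
  by rewrite [LHS]mulrA [RHS]mulrC.
by apply: cvgMr; exact: is_cvg_clifford.
Qed.

Lemma is_derive_half_pow n x :
  is_derive x (1 : R) (fun u : R => (u / 2) ^+ n) (n%:R * (x / 2) ^+ n.-1 / 2).
Proof.
have d : is_derive x (1 : R) (fun u : R => u / 2) (2^-1).
  have -> : (fun u : R => u / 2) = 2^-1 \*: (@id R).
    by apply/funext => u; rewrite /= mulrC.
  by apply: is_derive_eq; rewrite scaler1.
have -> : (fun u : R => (u / 2) ^+ n) = (fun u : R => u / 2) ^+ n.
  by apply/funext => u; rewrite exprfctE.
exact: is_deriveX.
Qed.

Lemma is_derive_besselJ_nat n x :
  is_derive x (1 : R) (besselJ_nat n)
    (n%:R * (x / 2) ^+ n.-1 / 2 * clifford n ((x / 2) ^+ 2)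
     - (x / 2) ^+ n.+1 * clifford n.+1 ((x / 2) ^+ 2)).
Proof.
have -> : besselJ_nat n = (fun u : R => (u / 2) ^+ n) *
    (clifford n \o (fun u : R => (u / 2) ^+ 2)).
  by apply/funext => u; rewrite besselJ_natE.
have d1 := is_derive_half_pow n x.
have d2 := @is_derive1_comp _ (clifford n) (fun u : R => (u / 2) ^+ 2) x _ _
  (is_derive_clifford n ((x / 2) ^+ 2))
  (is_derive_half_pow 2 x).
apply: is_derive_eq.
rewrite /= !scale_selfE expr1; set c := (x / 2) ^+ 2.
by rewrite exprS; field.
Qed.

Lemma besselJ_opp n x : besselJ (- n%:Z) x = (-1) ^+ n * besselJ_nat n x.
Proof. by case: n => [|n]; rewrite ?oppr0 /= ?expr0 ?mul1r// NegzE. Qed.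

(** Negative orders reduce to positive ones by [besselJ_opp]; the uniform shape over
    all integers is what lets sums of these derivatives telescope. *)
Lemma is_derive_besselJ m x :
  is_derive x (1 : R) (besselJ m) ((besselJ (m - 1) x - besselJ (m + 1) x) / 2).
Proof.
have dS n : is_derive x (1 : R) (besselJ_nat n.+1)
    ((besselJ_nat n x - besselJ_nat n.+2 x) / 2).
  apply: is_derive_eq (is_derive_besselJ_nat n.+1 x) _.
  have := clifford_rec n ((x / 2) ^+ 2); rewrite !besselJ_natE /=.
  move=> /eqP; rewrite subr_eq => /eqP ->.
  by rewrite !exprS; field.
case: m => n.
  case: n => [|n]; last first.
    have -> : n.+1%:Z - 1 = n by rewrite intS addrC addKr.
    have -> : n.+1%:Z + 1 = n.+2 by rewrite addrC -intS.
    exact: dS.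
  have -> : besselJ 0 = besselJ_nat 0 :> (R -> R) by [].
  apply: is_derive_eq (is_derive_besselJ_nat 0 x) _.
  by rewrite add0r (besselJ_opp 1) add0r /= besselJ_natE expr1; field.
have -> : besselJ (Negz n) = (-1) ^+ n.+1 \*: besselJ_nat n.+1 :> (R -> R) by [].
have -> : Negz n - 1 = - n.+2%:Z by rewrite NegzE -opprD [X in - X]addrC -intS.
have -> : Negz n + 1 = - n%:Z by rewrite NegzE intS opprD addrAC addNr add0r.
rewrite !besselJ_opp; have d := dS n.
by apply: is_derive_eq; rewrite scale_selfE !exprS; field.
Qed.

Lemma besselJ_at0 m : besselJ m 0 = (m == 0)%:R :> R.
Proof.
have H n : besselJ_nat n 0 = (n == 0)%:R :> R.
  rewrite besselJ_natE mul0r expr0n; case: n => [|n] /=; last by rewrite mul0r.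
  rewrite mul1r expr0n /= /clifford; apply/cvg_lim => //.
  rewrite -cvg_shiftS; apply: cvg_near_cst; apply: nearW => N.
  rewrite /pseries /series /= big_nat_recl// big1 ?addr0.
    by rewrite /clifford_coef !expr0 mulr1 mul1r add0n !fact0 invr1.
  by move=> i _; rewrite exprS mul0r mulr0.
by case: m => n /=; rewrite H ?mulr0.
Qed.

(** Decay in the order, uniform for [x] in [[0, z]].  The factor [(z / 2)^n / n!] is
    at most [2^-n exp z] because [z^n / n!] is a term of the series of [exp z]. *)
Lemma besselJ_le m x z : 0 <= x <= z ->
  `|besselJ m x| <= expR z * expR ((z / 2) ^+ 2) * 2^-1 ^+ `|m|.
Proof.
move=> /andP[x0 xz]; have z0 : 0 <= z by exact: le_trans xz.
have H n : `|besselJ_nat n x| <= expR z * expR ((z / 2) ^+ 2) * 2^-1 ^+ n.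
  rewrite besselJ_natE normrM normrX ger0_norm ?divr_ge0//.
  apply: le_trans (ler_wpM2l _ (clifford_le _ _)) _; first by rewrite exprn_ge0// divr_ge0.
  rewrite [leLHS](_ : _ = x ^+ n / n`!%:R * expR `|(x / 2) ^+ 2| * 2^-1 ^+ n).
    rewrite ler_wpM2r ?exprn_ge0 ?invr_ge0// ler_pM ?divr_ge0 ?exprn_ge0 ?expR_ge0//.
    - apply: (@le_trans _ _ (z ^+ n / n`!%:R)).
        by rewrite ler_wpM2r ?invr_ge0// lerXn2r ?nnegrE.
      case: n => [|n]; first by rewrite expr0 fact0 divr1 -expR0 ler_expR.
      by apply: le_trans (expR_ge1Dxn n z0); rewrite lerDr.
    - rewrite ler_expR ger0_norm ?exprn_ge0 ?divr_ge0//.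
      by rewrite lerXn2r ?nnegrE ?divr_ge0// ler_wpM2r ?invr_ge0.
  by rewrite expr_div_n exprVn; ring.
case: m => n; first exact: H.
by rewrite /= normrM normrX normrN1 expr1n mul1r; exact: H.
Qed.
End BesselCalculus.

(** * Sums over the symmetric windows [-N, N] *)

Section WindowSum.
Context {V : zmodType}.
Implicit Types (F G : int -> V) (N : nat).

Definition window_sum N F : V := \sum_(0 <= k < N.*2.+1) F (k%:Z - N%:Z).

(** The two boundary values that survive are, for Bessel terms, of order about [N],
    hence small: all the error estimates below come from here. *)
Lemma window_sum_telescope N F :
  window_sum N (fun m => F m - F (m + 1)) = F (- N%:Z) - F (N%:Z + 1).
Proof.
have := @telescope_sumr V 0 N.*2.+1 (fun k => F (k%:Z - N%:Z)) (leq0n _).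
rewrite sub0r (_ : N.*2.+1%:Z - N%:Z = N%:Z + 1); last by lia.
move=> T; rewrite -[RHS]opprB -T -sumrN; apply: eq_bigr => k _.
by rewrite opprB (_ : k.+1%:Z - N%:Z = k%:Z - N%:Z + 1)//; lia.
Qed.

Lemma window_sum1 N F m : (`|m| <= N)%N -> (forall n, n != m -> F n = 0) ->
  window_sum N F = F m.
Proof.
move=> mN F0; pose k := `|(m + N%:Z)%R|%N.
have kE : k%:Z = m + N%:Z by rewrite /k gez0_abs//; lia.
rewrite /window_sum big_mkord.
have kN : (k < N.*2.+1)%N by lia.
rewrite (bigD1 (Ordinal kN)) //= big1 ?addr0; first by rewrite kE addrK.
move=> i; rewrite -val_eqE /= => ik; apply: F0; apply/eqP => im.
by move/eqP: ik; apply; lia.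
Qed.
End WindowSum.

Section WindowSumR.
Context {R : realType}.
Implicit Types (F G : int -> R) (N : nat).

Lemma window_sumD N F G :
  window_sum N (fun m => F m + G m) = window_sum N F + window_sum N G.
Proof. exact: big_split. Qed.

Lemma window_sumB N F G :
  window_sum N (fun m => F m - G m) = window_sum N F - window_sum N G.
Proof. exact: sumrB. Qed.

Lemma window_sumZ N (c : R) F :
  window_sum N (fun m => c * F m) = c * window_sum N F.
Proof. by rewrite /window_sum mulr_sumr. Qed.

Lemma eq_window_sum N F G : F =1 G -> window_sum N F = window_sum N G.
Proof. by move=> FG; apply: eq_bigr => k _. Qed.

Lemma is_derive_window_sum N (F : int -> R -> R) (dF : int -> R) (x : R) :
  (forall m, is_derive x (1 : R) (F m) (dF m)) ->
  is_derive x (1 : R) (fun t => window_sum N (F ^~ t)) (window_sum N dF).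
Proof.
move=> dFm.
rewrite [X in is_derive _ _ X _](_ : _ =
    \sum_(i < N.*2.+1) F (i%:Z - N%:Z)).
  by rewrite /window_sum big_mkord; exact: is_derive_sum.
by apply/funext => t; rewrite /window_sum big_mkord fct_sumE.
Qed.
End WindowSumR.

(** * The Jacobi-Anger expansion with an error bound *)

Section JacobiAnger.
Context {R : realType}.
Implicit Types (x z t psi b : R) (N : nat) (m : int).

Definition bessel_tail x N : R := expR x * expR ((x / 2) ^+ 2) * 2^-1 ^+ N.

Lemma normr_cos_le (u v : R) : `|u * cos v| <= `|u|.
Proof. by rewrite normrM ler_piMr// ler_norml cos_geN1 cos_le1. Qed.

Lemma besselJ_le_tail (N : nat) m x z : (N <= `|m|)%N -> 0 <= x <= z ->
  `|besselJ m x| <= bessel_tail z N.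
Proof.
move=> Nm xz; apply: le_trans (besselJ_le m x z xz) _.
rewrite /bessel_tail ler_wpM2l ?mulr_ge0 ?expR_ge0//.
by rewrite ler_wiXn2l// ?invr_ge0// invf_le1// ler1n.
Qed.

Lemma cvg_bessel_tail x : bessel_tail x @ \oo --> 0.
Proof.
rewrite /bessel_tail -[X in _ --> X](mulr0 (expR x * expR ((x / 2) ^+ 2))).
apply: cvgMr; apply: cvg_expr.
by rewrite ger0_norm ?invr_ge0// invf_lt1// ltr1n.
Qed.

(** Jacobi-Anger: the partial sums of [sum_m J_m(x) e^(i m psi)] approach
    [e^(i x sin psi)].  Multiply the partial sum at [t] by [e^(-i t sin psi)]: by
    the recurrence for [J_m'] the derivative in [t] telescopes to four boundary
    terms, and at [t = 0] only [m = 0] contributes.  The mean value theorem on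
    [[0, x]] concludes.  The phase [b] covers real and imaginary parts together. *)
Lemma jacobi_anger x psi b N : 0 <= x ->
  `|window_sum N (fun m => besselJ m x * cos (m%:~R * psi + b))
    - cos (x * sin psi + b)| <= 2 * x * bessel_tail x N.
Proof.
move=> x0; pose s := sin psi.
(* the phase is shifted by x * s so that t * s is compensated at t = x *)
pose A t m := m%:~R * psi + (x * s + b) - t * s.
pose f t := window_sum N (fun m => besselJ m t * cos (A t m)).
pose df t : R := window_sum N (fun m =>
  (besselJ (m - 1) t - besselJ (m + 1) t) / 2 * cos (A t m)
  + besselJ m t * (s * sin (A t m))).
have dfE t : is_derive t (1 : R) f (df t).
  apply: is_derive_window_sum => m.
  have d1 := is_derive_besselJ m t.
  have d2 : is_derive t (1 : R) (fun u => A u m) (- s).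
    have -> : (fun u => A u m) = cst (m%:~R * psi + (x * s + b)) - s \*: (@id R).
      by apply/funext => u; rewrite /A /= [u * s]mulrC.
    by apply: is_derive_eq; rewrite sub0r scaler1.
  have d3 := @is_derive1_comp _ cos (fun u => A u m) t _ _ (is_derive_cos _) d2.
  have -> : (fun u => besselJ m u * cos (A u m)) =
     (besselJ m : R -> R) * (cos \o (fun u => A u m)) by [].
  by apply: is_derive_eq; rewrite /= !scale_selfE; ring.
have f0 : f 0 = cos (x * s + b).
  rewrite /f (window_sum1 _ _ 0)//.
    by rewrite besselJ_at0 eqxx mul1r /A mul0r mul0r add0r subr0.
  by move=> n n0; rewrite besselJ_at0 (negbTE n0) mul0r.
have fx : f x = window_sum N (fun m => besselJ m x * cos (m%:~R * psi + b)).
  by apply: eq_window_sum => m; congr (_ * cos _); rewrite /A; ring.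
have Ap t m : A t (m + 1) = A t m + psi by rewrite /A intrD; ring.
have Am t m : A t (m - 1) = A t m - psi by rewrite /A intrD; ring.
have dfT t : df t = 2^-1 * (
    (besselJ (- N%:Z - 1) t * cos (A t (- N%:Z))
     - besselJ (N%:Z + 1 - 1) t * cos (A t (N%:Z + 1)))
  + (besselJ (- N%:Z) t * cos (A t (- N%:Z - 1))
     - besselJ (N%:Z + 1) t * cos (A t (N%:Z + 1 - 1)))).
  rewrite -(window_sum_telescope N (fun m => besselJ (m - 1) t * cos (A t m))).
  rewrite -(window_sum_telescope N (fun m => besselJ m t * cos (A t (m - 1)))).
  rewrite -window_sumD -window_sumZ; apply: eq_window_sum => m.
  rewrite !addrK !Ap !Am; move: (A t m) => u.
  by rewrite cosD cosB -/s; field.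
have fC : {within `[0, x], continuous f}.
  apply: continuous_subspaceT => t.
  by apply/differentiable_continuous/derivable1_diffP; apply: ex_derive.
have [c cI fc] := @MVT_segment R f df 0 x x0 (fun t _ => dfE t) fC.
move: fc; rewrite f0 fx -/s subr0 => ->.
rewrite normrM (ger0_norm x0) mulrAC ler_wpM2r//.
have cx : 0 <= c <= x by move: cI; rewrite in_itv.
rewrite dfT.
have B m u : (N <= `|m|)%N -> `|besselJ m c * cos u| <= bessel_tail x N.
  by move=> Nm; apply: le_trans (normr_cos_le _ _) _; exact: besselJ_le_tail.
have := B (- N%:Z - 1) (A c (- N%:Z)); have := B (N%:Z + 1 - 1) (A c (N%:Z + 1)).
have := B (- N%:Z) (A c (- N%:Z - 1)); have := B (N%:Z + 1) (A c (N%:Z + 1 - 1)).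
set u1 := _ * cos _; set u2 := _ * cos _; set u3 := _ * cos _; set u4 := _ * cos _.
move=> h1 h2 h3 h4.
have {}h1 : `|u1| <= bessel_tail x N by apply: h1; lia.
have {}h2 : `|u2| <= bessel_tail x N by apply: h2; lia.
have {}h3 : `|u3| <= bessel_tail x N by apply: h3; lia.
have {}h4 : `|u4| <= bessel_tail x N by apply: h4; lia.
by move: h1 h2 h3 h4; rewrite !ler_norml; lra.
Qed.

(** The expansion of [d/dx e^(i x sin psi)]: replacing [J_m'] by
    [(J_(m-1) - J_(m+1)) / 2] and shifting the index gives two Jacobi-Anger sums
    with phases [b + psi] and [b - psi], up to boundary terms. *)
Lemma jacobi_anger_derive x psi b N : 0 <= x ->
  `|window_sum N (fun m => derive1 (besselJ m) x * cos (m%:~R * psi + b))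
    + sin psi * sin (x * sin psi + b)| <= 2 * (x + 1) * bessel_tail x N.
Proof.
move=> x0; set s := sin psi.
pose S c := window_sum N (fun m => besselJ m x * cos (m%:~R * psi + c)).
have E : window_sum N (fun m => derive1 (besselJ m) x * cos (m%:~R * psi + b))
   = 2^-1 * (S (b + psi) - S (b - psi)
   + ((besselJ (- N%:Z - 1) x * cos ((- N%:Z)%:~R * psi + b)
     - besselJ (N%:Z + 1 - 1) x * cos ((N%:Z + 1)%:~R * psi + b))
  + (besselJ (- N%:Z) x * cos ((- N%:Z - 1)%:~R * psi + b)
     - besselJ (N%:Z + 1) x * cos ((N%:Z + 1 - 1)%:~R * psi + b)))).
  rewrite -(window_sum_telescope N (fun m => besselJ (m - 1) x * cos (m%:~R * psi + b))).
  rewrite -(window_sum_telescope N (fun m => besselJ m x * cos ((m - 1)%:~R * psi + b))).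
  rewrite -window_sumB -!window_sumD -window_sumZ; apply: eq_window_sum => m.
  rewrite derive1E (@derive_val _ _ _ _ _ _ _ (is_derive_besselJ m x)) !addrK.
  have -> : (m + 1)%:~R * psi + b = m%:~R * psi + (b + psi).
    by rewrite intrD mulrDl mul1r -addrA (addrC psi).
  have -> : (m - 1)%:~R * psi + b = m%:~R * psi + (b - psi).
    by rewrite intrD mulrDl mulN1r -addrA (addrC (- psi)).
  by field.
have := jacobi_anger x psi (b + psi) N x0; have := jacobi_anger x psi (b - psi) N x0.
rewrite -/(S (b + psi)) -/(S (b - psi)) -/s E.
rewrite !(addrA (x * s)) (cosD _ psi) (cosB _ psi) -/s.
have B m u : (N <= `|m|)%N -> `|besselJ m x * cos u| <= bessel_tail x N.
  move=> Nm; apply: le_trans (normr_cos_le _ _) _; apply: besselJ_le_tail => //.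
  by rewrite x0 lexx.
have := B (- N%:Z - 1) ((- N%:Z)%:~R * psi + b).
have := B (N%:Z + 1 - 1) ((N%:Z + 1)%:~R * psi + b).
have := B (- N%:Z) ((- N%:Z - 1)%:~R * psi + b).
have := B (N%:Z + 1) ((N%:Z + 1 - 1)%:~R * psi + b).
set u1 := _ * cos _; set u2 := _ * cos _; set u3 := _ * cos _; set u4 := _ * cos _.
move=> h1 h2 h3 h4.
have {}h1 : `|u1| <= bessel_tail x N by apply: h1; lia.
have {}h2 : `|u2| <= bessel_tail x N by apply: h2; lia.
have {}h3 : `|u3| <= bessel_tail x N by apply: h3; lia.
have {}h4 : `|u4| <= bessel_tail x N by apply: h4; lia.
move: h1 h2 h3 h4; rewrite !ler_norml.
set T := bessel_tail x N; move=> *; nra.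
Qed.
End JacobiAnger.

(** * Integration over one period *)

Section CircleMean.
Context {R : realType}.
Implicit Types (f g : R -> R) (a b e : R) (n m : int).

Definition periodint f : R :=
  (\int[lebesgue_measure]_(t in `[0%R, (2 * pi)%R]) f t)%R.

Let pi2_gt0 : 0 < 2 * pi :> R. Proof. by rewrite mulr_gt0// pi_gt0. Qed.

Lemma periodint_integrable f : continuous f ->
  (@lebesgue_measure R).-integrable `[0, 2 * pi] (EFin \o f).
Proof.
move=> fC; apply: continuous_compact_integrable; first exact: segment_compact.
exact: continuous_subspaceT.
Qed.

Lemma eq_periodint f g : f =1 g -> periodint f = periodint g.
Proof. by move=> fg; apply: eq_Rintegral => t _. Qed.

Lemma periodintD f g : continuous f -> continuous g ->
  periodint (fun t => f t + g t) = periodint f + periodint g.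
Proof. by move=> fC gC; apply: RintegralD => //; exact: periodint_integrable. Qed.

Lemma periodintB f g : continuous f -> continuous g ->
  periodint (fun t => f t - g t) = periodint f - periodint g.
Proof. by move=> fC gC; apply: RintegralB => //; exact: periodint_integrable. Qed.

Lemma periodintZ (c : R) f : continuous f ->
  periodint (fun t => c * f t) = c * periodint f.
Proof. by move=> fC; apply: RintegralZl => //; exact: periodint_integrable. Qed.

Lemma periodint_cst (c : R) : periodint (fun=> c) = 2 * pi * c.
Proof.
rewrite /periodint Rintegral_cst// [RHS]mulrC.
apply: etrans (congr1 (fun v => c * fine v) (lebesgue_measure_itv `[0, 2 * pi]%R)) _.
by rewrite /= lte_fin pi2_gt0 oppr0 adde0.
Qed.

Lemma periodint_le f e : continuous f -> (forall t, `|f t| <= e) ->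
  `|periodint f| <= 2 * pi * e.
Proof.
move=> fC fe; rewrite -periodint_cst.
apply: le_trans (le_normr_Rintegral _ (periodint_integrable _ fC)) _ => //.
apply: le_Rintegral => //.
- by apply: (periodint_integrable (fun t => `|f t|)) => t; apply: cvg_norm; exact: fC.
- by apply: (periodint_integrable (fun=> e)) => t; exact: cvg_cst.
Qed.

Lemma periodint_sum (I : Type) (s : seq I) (F : I -> R -> R) :
  (forall i, continuous (F i)) ->
  continuous (fun t => \sum_(i <- s) F i t) /\
  periodint (fun t => \sum_(i <- s) F i t) = \sum_(i <- s) periodint (F i).
Proof.
move=> FC; elim: s => [|i s [IC IE]].
  split.
    rewrite (_ : (fun _ => _) = cst 0); last by apply/funext => t; rewrite big_nil.
    by move=> t; exact: cvg_cst.
  rewrite big_nil (eq_periodint _ (fun=> 0)); last by move=> t; rewrite big_nil.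
  by rewrite periodint_cst mulr0.
have E t : \sum_(j <- i :: s) F j t = F i t + \sum_(j <- s) F j t by rewrite big_cons.
split.
  rewrite (funext E) => t; apply: cvgD; [exact: FC|exact: IC].
by rewrite (eq_periodint _ _ E) periodintD// IE big_cons.
Qed.

Lemma cvg_periodint (f_ : nat -> R -> R) f (e : nat -> R) :
  (forall N, continuous (f_ N)) -> continuous f ->
  (forall N t, `|f_ N t - f t| <= e N) -> e @ \oo --> 0 ->
  periodint (f_ N) @[N --> \oo] --> periodint f.
Proof.
move=> fNC fC fNf e0; apply/cvgrPdist_le => d d0.
have : (fun N => 2 * pi * e N) @ \oo --> 0.
  by rewrite -(mulr0 (2 * pi)); apply: cvgMr.
move=> /cvgrPdist_le/(_ d d0); apply: filter_app; near=> N => /=.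
rewrite sub0r normrN distrC => h; rewrite -periodintB//.
apply: le_trans (periodint_le _ (e N) _ _) _ => //.
  by move=> t; apply: cvgB; [exact: fNC|exact: fC].
by apply: le_trans h; exact: ler_norm.
Unshelve. all: by end_near. Qed.

Lemma cos_sin_2piz n :
  cos (n%:~R * (2 * pi)) = 1 :> R /\ sin (n%:~R * (2 * pi)) = 0 :> R.
Proof.
have H k : cos (k%:R * (2 * pi)) = 1 :> R /\ sin (k%:R * (2 * pi)) = 0 :> R.
  have -> : k%:R * (2 * pi) = 0 + (pi *+ 2) *+ k :> R.
    by rewrite add0r mulr_natl mulr_natl.
  by rewrite (periodicn (@cosD2pi R)) (periodicn (@sinD2pi R)) cos0 sin0.
case: n => n; first exact: H.
by rewrite NegzE mulrNz mulNr cosN sinN !(H n.+1).1 !(H n.+1).2 oppr0.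
Qed.

Lemma cosD2piz n b : cos (b + n%:~R * (2 * pi)) = cos b.
Proof. by rewrite cosD (cos_sin_2piz n).1 (cos_sin_2piz n).2 mulr1 mulr0 subr0. Qed.

Lemma sinD2piz n b : sin (b + n%:~R * (2 * pi)) = sin b.
Proof. by rewrite sinD (cos_sin_2piz n).1 (cos_sin_2piz n).2 mulr1 mulr0 addr0. Qed.

Lemma is_derive_affine k b t : is_derive t (1 : R) (fun t : R => k * t + b) k.
Proof.
have -> : (fun t : R => k * t + b) = k \*: (@id R) + cst b by [].
by apply: is_derive_eq; rewrite addr0 scaler1.
Qed.

Lemma continuous_affine k b : continuous (fun t : R => k * t + b).
Proof.
move=> t; apply/differentiable_continuous/derivable1_diffP.
by have [] := is_derive_affine k b t.
Qed.

Lemma continuous_cos_affine k b : continuous (fun t : R => cos (k * t + b)).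
Proof.
move=> t; apply: (@continuous_comp _ _ _ (fun t : R => k * t + b) cos).
  exact: continuous_affine.
exact: continuous_cos.
Qed.

Lemma continuous_shift f a : continuous f -> continuous (fun t => f (t + a)).
Proof.
move=> fC t; apply: (@continuous_comp _ _ _ (fun t : R => t + a) f); last exact: fC.
by apply: cvgD; [exact: cvg_id|exact: cvg_cst].
Qed.

Lemma periodint_cos n b :
  periodint (fun t => cos (n%:~R * t + b)) = if n == 0 then 2 * pi * cos b else 0.
Proof.
case: eqP => [->|/eqP n0].
  rewrite -periodint_cst; apply: eq_periodint => t.
  by rewrite mul0r add0r.
have nR : n%:~R != 0 :> R by rewrite intr_eq0.
pose F t : R := n%:~R^-1 * sin (n%:~R * t + b).
have dF t : is_derive t (1 : R) F (cos (n%:~R * t + b)).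
  have d1 := @is_derive1_comp _ sin (fun t : R => n%:~R * t + b) t _ _ (is_derive_sin _)
    (is_derive_affine n%:~R b t).
  have -> : F = n%:~R^-1 \*: (sin \o (fun t : R => n%:~R * t + b)) by [].
  by apply: is_derive_eq; rewrite scale_selfE mulrCA mulVf// mulr1.
have FC : continuous F.
  move=> t; apply/differentiable_continuous/derivable1_diffP.
  by have [] := dF t.
rewrite /periodint /Rintegral (@continuous_FTC2 _ _ F)//.
- by rewrite /= /F mulr0 add0r [_ * (2 * pi) + b]addrC sinD2piz subrr.
- exact: continuous_subspaceT (continuous_cos_affine _ _).
- split.
  + by move=> t _; have [] := dF t.
  + exact: cvg_at_right_filter (FC 0).
  + exact: cvg_at_left_filter (FC _).
- by move=> t _; rewrite derive1E; have [] := dF t.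
Qed.

End CircleMean.

(** * Parseval's identity for two rotated copies of a function *)

Section Correlation.
Context {R : realType}.
Implicit Types (A B : R -> R) (a b d t : R).

(** The real part of [e^(i d) F(t + a) conj(F(t + b))] for [F = A + i B]. *)
Definition corr A B a b d t : R :=
  (A (t + a) * A (t + b) + B (t + a) * B (t + b)) * cos d
  - (B (t + a) * A (t + b) - A (t + a) * B (t + b)) * sin d.

Lemma continuous_corr A B a b d :
  continuous A -> continuous B -> continuous (corr A B a b d).
Proof.
move=> AC BC t; apply: cvgB; apply: cvgMl.
  by apply: cvgD; apply: cvgM; exact: continuous_shift.
by apply: cvgB; apply: cvgM; exact: continuous_shift.
Qed.
End Correlation.

Section Parseval.
(* A + i B is a 2 pi-periodic function with Fourier coefficients c_m, the real
   parts of the partial Fourier sums, rotated by any phase b, being uniformly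
   close to those of A + i B. *)
Context {R : realType} (c : int -> R) (A B : R -> R) (e : nat -> R)
  (AC : continuous A) (BC : continuous B)
  (A1 : forall t, `|A t| <= 1) (B1 : forall t, `|B t| <= 1)
  (cE : forall psi b N,
     `|window_sum N (fun m => c m * cos (m%:~R * psi + b))
       - (A psi * cos b - B psi * sin b)| <= e N)
  (e0 : e @ \oo --> 0).

Lemma continuous_mode m a b d : continuous (fun t =>
  A (t + a) * cos (d - m%:~R * (t + b)) - B (t + a) * sin (d - m%:~R * (t + b))).
Proof.
have dC : continuous (fun t : R => d - m%:~R * (t + b)).
  rewrite (_ : (fun t : R => _) = (fun t : R => (- m%:~R) * t + (d - m%:~R * b))).
    exact: continuous_affine.
  by apply/funext => t; ring.
move=> t; apply: cvgB; apply: cvgM; try exact: continuous_shift.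
- by apply: (@continuous_comp _ _ _ (fun t : R => d - m%:~R * (t + b)) cos);
    [exact: dC|exact: continuous_cos].
- by apply: (@continuous_comp _ _ _ (fun t : R => d - m%:~R * (t + b)) sin);
    [exact: dC|exact: continuous_sin].
Qed.

(** The expansion of [F] may be integrated term by term against one mode since it
    converges uniformly, and orthogonality keeps a single term. *)
Lemma fourier_coef_mode m a b d :
  periodint (fun t => A (t + a) * cos (d - m%:~R * (t + b))
                    - B (t + a) * sin (d - m%:~R * (t + b)))
  = 2 * pi * (c m * cos (m%:~R * (a - b) + d)).
Proof.
pose f_ N t := window_sum N (fun n =>
  c n * cos (n%:~R * (t + a) + (d - m%:~R * (t + b)))).
pose T n t := c n * cos ((n - m)%:~R * t + (n%:~R * a - m%:~R * b + d)).
have f_E N t : f_ N t = \sum_(k <- index_iota 0 N.*2.+1) T (k%:Z - N%:Z) t.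
  apply: eq_bigr => k _; rewrite /T; congr (_ * cos _).
  by rewrite !intrB; ring.
have TC n : continuous (T n).
  by move=> t; apply: cvgMr; exact: continuous_cos_affine.
have lim1 : periodint (f_ N) @[N --> \oo] -->
  periodint (fun t => A (t + a) * cos (d - m%:~R * (t + b))
                    - B (t + a) * sin (d - m%:~R * (t + b))).
  apply: (cvg_periodint _ _ e) => //.
  - move=> N; rewrite (funext (f_E N)).
    by have [] := periodint_sum _ (index_iota 0 N.*2.+1) (fun k => T (k%:Z - N%:Z))
      (fun k => TC _).
  - exact: continuous_mode.
  - by move=> N t; exact: cE.
have lim2 : periodint (f_ N) @[N --> \oo] -->
  2 * pi * (c m * cos (m%:~R * (a - b) + d)).
  apply: cvg_near_cst; near=> N.
  rewrite (eq_periodint _ _ (f_E N)).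
  rewrite (periodint_sum _ _ (fun k => T (k%:Z - N%:Z)) (fun k => TC _)).2.
  rewrite -[LHS]/(window_sum N (fun n => periodint (T n))).
  rewrite (window_sum1 _ _ m).
  - rewrite /T periodintZ; last exact: continuous_cos_affine.
    by rewrite periodint_cos subrr eqxx mulrCA; congr (_ * (_ * cos _)); ring.
  - by near: N; exact: nbhs_infty_ge.
  - move=> n nm; rewrite /T periodintZ; last exact: continuous_cos_affine.
    by rewrite periodint_cos subr_eq0 (negbTE nm) mulr0.
exact: cvg_unique lim1 lim2.
Unshelve. all: by end_near. Qed.

(** Expanding only the factor at [t + b] makes each term an integral of
    [F(t + a)] against one mode, computed by [fourier_coef_mode]; no double sum
    appears. *)
Lemma parseval a b d :
  window_sum N (fun m => 2 * pi * (c m ^+ 2 * cos (m%:~R * (a - b) + d)))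
    @[N --> \oo] -->
  periodint (corr A B a b d).
Proof.
pose T m t := c m * (A (t + a) * cos (d - m%:~R * (t + b))
                    - B (t + a) * sin (d - m%:~R * (t + b))).
have TC m : continuous (T m) by move=> t; apply: cvgMr; exact: continuous_mode.
have SE N := periodint_sum _ (index_iota 0 N.*2.+1) (fun k => T (k%:Z - N%:Z))
  (fun k => TC _).
rewrite (_ : (fun N => _) = fun N => periodint (fun t => window_sum N (T ^~ t))).
  apply: (cvg_periodint _ _ (fun N => 2 * e N)).
  - by move=> N; have [] := SE N.
  - exact: continuous_corr.
  - move=> N t.
    (* the factor at t + b enters through its real and its imaginary part, the
       latter being the real part after a rotation by - pi / 2 *)
    have h1 := cE (t + b) (- d) N; have h2 := cE (t + b) (- d - pi / 2) N.
    set S1 := window_sum _ _ in h1; set S2 := window_sum _ _ in h2.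
    have -> : window_sum N (T ^~ t) = A (t + a) * S1 + B (t + a) * S2.
      rewrite -!window_sumZ -window_sumD; apply: eq_window_sum => m; rewrite /T.
      rewrite -[d - _]opprB cosN sinN !(addrA _ (- d)) (cosB _ (pi / 2)).
      rewrite sin_pihalf cos_pihalf.
      by ring.
    move: h1 h2; rewrite cosN sinN (cosB _ (pi / 2)) (sinB _ (pi / 2)).
    rewrite cosN sinN sin_pihalf cos_pihalf.
    set P := _ - _ => h1; set Q := _ - _ => h2.
    rewrite [X in `|X|](_ : _ = A (t + a) * P + B (t + a) * Q); last first.
      by rewrite /P /Q /corr; ring.
    apply: le_trans (ler_normD _ _) _; rewrite !normrM.
    have := ler_pM (normr_ge0 _) (normr_ge0 _) (A1 (t + a)) h1.
    have := ler_pM (normr_ge0 _) (normr_ge0 _) (B1 (t + a)) h2.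
    lra.
  - by rewrite -(mulr0 2); apply: cvgMr.
apply/funext => N; rewrite (SE N).2; apply: eq_bigr => k _.
by rewrite /T periodintZ ?fourier_coef_mode; [ring|exact: continuous_mode].
Qed.
End Parseval.

(** * From symmetric windows to unconditional sums *)

Section UnconditionalSum.
Context {R : realType}.
Implicit Types (N K : nat) (m : int) (A B : {fset int}).

Definition window N : {fset int} :=
  seq_fset tt [seq k%:Z - N%:Z | k <- index_iota 0 N.*2.+1].

Lemma mem_window N m : (m \in window N) = (`|m| <= N)%N.
Proof.
rewrite seq_fsetE; apply/mapP/idP => [[k]|mN].
  by rewrite mem_index_iota => kN ->; lia.
exists `|(m + N%:Z)%R|%N; first by rewrite mem_index_iota; lia.
by lia.
Qed.

Lemma big_window (V : zmodType) N (F : int -> V) :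
  \sum_(m <- window N) F m = window_sum N F.
Proof.
rewrite /window_sum -(big_map (fun k : nat => k%:Z - N%:Z) xpredT F).
apply: perm_big; apply: uniq_perm; first exact: fset_uniq.
  rewrite map_inj_uniq ?iota_uniq// => i j /eqP.
  by rewrite (inj_eq (addIr _)) => /eqP[].
exact: seq_fsetE.
Qed.

Lemma big_fset_split (V : zmodType) A B (F : int -> V) : (B `<=` A)%fset ->
  \sum_(m <- A) F m = \sum_(m <- B) F m + \sum_(m <- (A `\` B)%fset) F m.
Proof.
move=> /fsubsetP BA; rewrite -big_cat /=; apply: perm_big; apply: uniq_perm.
- exact: fset_uniq.
- rewrite cat_uniq !fset_uniq /= andbT; apply/hasPn => m.
  by rewrite in_fsetD => /andP[].
- move=> m; rewrite mem_cat in_fsetD.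
  by case: (boolP (m \in B)) => [/BA ->|_]//.
Qed.

Lemma ler_sum_fset A B (F : int -> R) : (forall m, 0 <= F m) -> (B `<=` A)%fset ->
  \sum_(m <- B) F m <= \sum_(m <- A) F m.
Proof.
by move=> F0 BA; rewrite (big_fset_split _ A B)// lerDl sumr_ge0.
Qed.

Lemma window_homo N K : (N <= K)%N -> (window N `<=` window K)%fset.
Proof.
move=> NK; apply/fsubsetP => m; rewrite !mem_window => mN; exact: leq_trans mN NK.
Qed.

Lemma fsubset_window A : exists K, (A `<=` window K)%fset.
Proof.
exists (\max_(m <- A) `|m|%N)%N; apply/fsubsetP => m mA; rewrite mem_window.
by rewrite (big_rem m)//= leq_maxl.
Qed.

(** A finite set lies in some larger window, whose sum is at most the limit. *)
Lemma window_sum_tail N A (b : int -> R) (l : R) : (forall m, 0 <= b m) ->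
  window_sum K b @[K --> \oo] --> l -> (window N `<=` A)%fset ->
  \sum_(m <- (A `\` window N)%fset) b m <= l - window_sum N b.
Proof.
move=> b0 bl NA; have [K AK] := fsubset_window A.
have bK : window_sum K b <= l.
  rewrite -(cvg_lim _ bl)//.
  apply: (@nondecreasing_cvgn_le R (fun K => window_sum K b)).
    by move=> i j ij; rewrite -!big_window ler_sum_fset// window_homo.
  by apply/cvg_ex; exists l.
rewrite lerBrDl -big_window -big_fset_split//.
by apply: le_trans bK; rewrite -big_window ler_sum_fset.
Qed.

Lemma normc_le (z : R[i]) : `|z| <= (`|complex.Re z| + `|complex.Im z|)%:C.
Proof.
rewrite normc_def lecR.
rewrite -[leRHS](ger0_norm (addr_ge0 (normr_ge0 _) (normr_ge0 _))).
rewrite -sqrtr_sqr ler_sqrt ?sqr_ge0//.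
by rewrite sqrrD !real_normK ?num_real// lerD2r lerDl mulrn_wge0.
Qed.

(** Under a summable majorant [b], convergence along symmetric windows upgrades to
    convergence along all finite sets: beyond the window [N], any finite set
    contributes at most the tail of [b]. *)
Lemma cvg_csum_partial (a : int -> R[i]) (b : int -> R) (l x y : R) :
  (forall m, `|a m| <= (b m)%:C) -> window_sum N b @[N --> \oo] --> l ->
  window_sum N (fun m => complex.Re (a m)) @[N --> \oo] --> x ->
  window_sum N (fun m => complex.Im (a m)) @[N --> \oo] --> y ->
  csum_partial setT a A @[A --> @summability.totally int] --> (x +i* y : R[i]^o).
Proof.
move=> ab bl ax ay.
have b0 m : 0 <= b m by rewrite -ler0c; apply: le_trans (ab m).
apply/cvgrPdist_le => e; rewrite ltcE /= => /andP[/eqP eI eR].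
have -> : e = (complex.Re e)%:C by apply/eqP; rewrite eq_complex/= eI !eqxx.
set r := complex.Re e in eR *; have r3 : 0 < r / 3 by rewrite divr_gt0.
have [N [hb hx hy]] : exists N, [/\ `|l - window_sum N b| <= r / 3,
   `|x - window_sum N (fun m => complex.Re (a m))| <= r / 3 &
   `|y - window_sum N (fun m => complex.Im (a m))| <= r / 3].
  move/cvgrPdist_le : bl => /(_ _ r3) bl.
  move/cvgrPdist_le : ax => /(_ _ r3) ax.
  move/cvgrPdist_le : ay => /(_ _ r3) ay.
  have [N _ H] := filterI bl (filterI ax ay).
  by exists N; have [h1 [h2 h3]] := H N (leqnn N); split.
exists (window N) => // A /= NA.
have -> : csum_partial setT a A = \sum_(m <- A) a m.
  by apply: eq_bigl => m; rewrite in_setT.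
rewrite (big_fset_split _ A (window N))// big_window opprD addrA.
apply: le_trans (ler_normB _ _) _.
have -> : r = r / 3 + r / 3 + r / 3 by field.
rewrite 2!rmorphD /= lerD//.
  apply: le_trans (normc_le _) _; rewrite -rmorphD lecR.
  by rewrite !raddfB /= lerD// /window_sum raddf_sum.
apply: le_trans (ler_norm_sum _ _ _) _.
apply: (@le_trans _ _ (\sum_(m <- (A `\` window N)%fset) b m)%:C).
  by rewrite rmorph_sum; apply: ler_sum => m _; exact: ab.
rewrite lecR; apply: le_trans (window_sum_tail N A b l b0 bl NA) _.
by apply: le_trans hb; exact: ler_norm.
Qed.
End UnconditionalSum.

(** * The trace inner product of two plane waves *)

Section PlaneWaveTrace.
Context {R : realType}.
Implicit Types (kappa h theta t psi z a b d : R).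

Definition correlation (A B : R -> R) a b d : R := periodint (corr A B a b d).

(** With [psi = t + pi / 2 - theta] and [z = kappa h], the plane wave at the point of
    angle [t] on the circle is [e^(i z sin psi)], and its normal derivative is
    [kappa] times the derivative of this in [z]. *)
Definition wave_re z psi : R := cos (z * sin psi).
Definition wave_im z psi : R := sin (z * sin psi).
Definition dwave_re z psi : R := - (sin psi * sin (z * sin psi)).
Definition dwave_im z psi : R := sin psi * cos (z * sin psi).

Lemma continuous_sin_scaled z : continuous (fun psi : R => z * sin psi).
Proof. by move=> t; apply: cvgMr; exact: continuous_sin. Qed.

Lemma continuous_wave_re z : continuous (wave_re z).
Proof.
move=> t; apply: (@continuous_comp _ _ _ (fun psi : R => z * sin psi) cos).
  exact: continuous_sin_scaled.
exact: continuous_cos.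
Qed.

Lemma continuous_wave_im z : continuous (wave_im z).
Proof.
move=> t; apply: (@continuous_comp _ _ _ (fun psi : R => z * sin psi) sin).
  exact: continuous_sin_scaled.
exact: continuous_sin.
Qed.

Lemma continuous_dwave_re z : continuous (dwave_re z).
Proof.
move=> t; apply: cvgN; apply: cvgM; first exact: continuous_sin.
exact: continuous_wave_im.
Qed.

Lemma continuous_dwave_im z : continuous (dwave_im z).
Proof.
move=> t; apply: cvgM; first exact: continuous_sin.
exact: continuous_wave_re.
Qed.

Lemma normr_sin_le1 t : `|sin t| <= 1.
Proof. by rewrite ler_norml sin_geN1 sin_le1. Qed.

Lemma normr_cos_le1 t : `|cos t| <= 1.
Proof. by rewrite ler_norml cos_geN1 cos_le1. Qed.

Lemma wave_parseval z a b d : 0 <= z ->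
  window_sum N (fun m => 2 * pi * (besselJ m z ^+ 2 * cos (m%:~R * (a - b) + d)))
    @[N --> \oo] --> correlation (wave_re z) (wave_im z) a b d.
Proof.
move=> z0.
apply: (parseval _ _ _ (fun N => 2 * z * bessel_tail z N)).
- exact: continuous_wave_re.
- exact: continuous_wave_im.
- by move=> t; exact: normr_cos_le1.
- by move=> t; exact: normr_sin_le1.
- by move=> psi c N; rewrite -cosD; exact: jacobi_anger.
- by rewrite -[X in _ --> X](mulr0 (2 * z)); apply: cvgMr; exact: cvg_bessel_tail.
Qed.

Lemma dwave_parseval z a b d : 0 <= z ->
  window_sum N (fun m =>
    2 * pi * (derive1 (besselJ m) z ^+ 2 * cos (m%:~R * (a - b) + d)))
    @[N --> \oo] --> correlation (dwave_re z) (dwave_im z) a b d.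
Proof.
move=> z0.
apply: (parseval (fun m => derive1 (besselJ m) z) _ _
  (fun N => 2 * (z + 1) * bessel_tail z N)).
- exact: continuous_dwave_re.
- exact: continuous_dwave_im.
- by move=> t; rewrite normrN normrM mulr_ile1// normr_sin_le1.
- by move=> t; rewrite normrM mulr_ile1// ?normr_sin_le1 ?normr_cos_le1.
- move=> psi c N.
  rewrite (_ : dwave_re z psi * cos c - dwave_im z psi * sin c =
    - (sin psi * sin (z * sin psi + c))); last first.
    by rewrite sinD /dwave_re /dwave_im; ring.
  by rewrite opprK; exact: jacobi_anger_derive.
- rewrite -[X in _ --> X](mulr0 (2 * (z + 1))); apply: cvgMr.
  exact: cvg_bessel_tail.
Qed.

Lemma dot2_dir theta t : dot2 (dir theta) (dir t) = sin (t + (pi / 2 - theta)).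
Proof.
rewrite /dot2 big_ord_recl big_ord1 !mxE /=.
rewrite (_ : t + (pi / 2 - theta) = t - theta + pi / 2); last by ring.
by rewrite sinDpihalf cosB mulrC [sin _ * _]mulrC.
Qed.

Lemma dot2Z (u v : 'rV[R]_2) (c : R) : dot2 u (c *: v) = c * dot2 u v.
Proof. by rewrite /dot2 mulr_sumr; apply: eq_bigr => i _; rewrite mxE mulrCA. Qed.

Lemma dot2D (u v w : 'rV[R]_2) : dot2 u (v + w) = dot2 u v + dot2 u w.
Proof. by rewrite /dot2 -big_split; apply: eq_bigr => i _; rewrite mxE mulrDr. Qed.

(** Along the line through [y] in direction [n] the ridge function is a function of
    one affine real variable. *)
Lemma derive_ridge (f : R -> R) (df k : R) (u n y x0 : 'rV[R]_2) :
  is_derive (k * dot2 u (y - x0)) (1 : R) f df ->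
  'D_n (fun w => f (k * dot2 u (w - x0))) y = k * dot2 u n * df.
Proof.
move=> fd; pose g (s : R) := f (k * dot2 u n * s + k * dot2 u (y - x0)).
have gd : is_derive (0 : R) (1 : R) g (df * (k * dot2 u n)).
  apply: (@is_derive1_comp _ f (fun s => k * dot2 u n * s + k * dot2 u (y - x0))).
    by rewrite mulr0 add0r.
  exact: is_derive_affine.
rewrite [RHS]mulrC -(@derive_val _ _ _ _ _ _ _ gd) /derive.
have fE (q1 q2 : R -> R^o) : q1 = q2 -> lim (q1 @ 0^') = lim (q2 @ 0^') by move=> ->.
apply: fE; apply/funext => s /=; congr (_ *: (f _ - f _)).
  rewrite -(addrA (s *: n)) [dot2 u (_ + (y - x0))]dot2D dot2Z addr0 [s *: 1]mulr1; ring.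
by rewrite mulr0 add0r.
Qed.

(** The weights [kappa] and [kappa^-1] combine with the factor [kappa^2] from the two
    normal derivatives and the arc length [h dt] to one common factor [kappa h].
    The phases [0] and [- pi / 2] select real and imaginary parts. *)
Lemma trace_ip_plane_waveE kappa h x0 theta theta' : 0 < kappa -> 0 < h ->
  let a := pi / 2 - theta in let b := pi / 2 - theta' in
  let z := kappa * h in
  let S d := correlation (wave_re z) (wave_im z) a b d
           + correlation (dwave_re z) (dwave_im z) a b d in
  trace_ip kappa x0 h (plane_wave kappa x0 theta) (plane_wave kappa x0 theta')
  = (z * S 0) +i* (z * S (- (pi / 2))).
Proof.
move=> kappa0 h0 a b z S.
have kN0 : kappa != 0 by rewrite gt_eqF.
have hN0 : h != 0 by rewrite gt_eqF.
have xE t : x0 + h *: dir t - x0 = h *: dir t by rewrite addrC addKr.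
have pwE th t : plane_wave kappa x0 th (x0 + h *: dir t) =
    wave_re z (t + (pi / 2 - th)) +i* wave_im z (t + (pi / 2 - th)).
  by rewrite /plane_wave /expi xE dot2Z dot2_dir mulrA.
have ndE th t : normal_derive x0 h (plane_wave kappa x0 th) (x0 + h *: dir t) =
    kappa%:C * (dwave_re z (t + (pi / 2 - th)) +i* dwave_im z (t + (pi / 2 - th))).
  rewrite /normal_derive xE scalerA mulVf// scale1r.
  rewrite (derive_ridge cos _ _ _ _ _ _ (is_derive_cos _)).
  rewrite (derive_ridge sin _ _ _ _ _ _ (is_derive_sin _)).
  rewrite xE dot2Z dot2_dir mulrA -/z /dwave_re /dwave_im.
  by apply/eqP; rewrite eq_complex /= !mul0r subr0 addr0 !mulrN !mulrA !eqxx.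
have SE d : z * S d = periodint (fun t => z *
    (corr (wave_re z) (wave_im z) a b d t + corr (dwave_re z) (dwave_im z) a b d t)).
  have wC := continuous_corr _ _ a b d (continuous_wave_re z) (continuous_wave_im z).
  have dC := continuous_corr _ _ a b d (continuous_dwave_re z) (continuous_dwave_im z).
  rewrite periodintZ; first by rewrite periodintD.
  by move=> t; apply: cvgD; [exact: wC|exact: dC].
rewrite /trace_ip /circle_int !SE /corr cosN sinN cos0 sin0 cos_pihalf sin_pihalf.
congr (_ +i* _); apply: eq_periodint => t; rewrite !pwE !ndE -/a -/b /=.
  by rewrite /z; field.
by rewrite /z; field.
Qed.

Lemma cvg_trace_sum kappa h x0 theta theta' : 0 < kappa -> 0 < h ->
  let a (m : int) : R[i] :=
    (tau2 kappa h m)%:C * expi (- (m%:~R * (theta - theta'))) in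
  let T := trace_ip kappa x0 h
    (plane_wave kappa x0 theta) (plane_wave kappa x0 theta') in
  window_sum N (fun m => complex.Re (a m)) @[N --> \oo] --> complex.Re T /\
  window_sum N (fun m => complex.Im (a m)) @[N --> \oo] --> complex.Im T.
Proof.
move=> kappa0 h0 a T; rewrite /T trace_ip_plane_waveE//=.
set z := kappa * h; have z0 : 0 <= z by rewrite ltW// mulr_gt0.
have L d : window_sum N (fun m => tau2 kappa h m
      * cos (- (m%:~R * (theta - theta')) + d)) @[N --> \oo] -->
    z * (correlation (wave_re z) (wave_im z) (pi / 2 - theta) (pi / 2 - theta') d
     + correlation (dwave_re z) (dwave_im z) (pi / 2 - theta) (pi / 2 - theta') d).
  have w := wave_parseval z (pi / 2 - theta) (pi / 2 - theta') d z0.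
  have dw := dwave_parseval z (pi / 2 - theta) (pi / 2 - theta') d z0.
  rewrite (_ : (fun N => _) = fun N => z *
     (window_sum N (fun m => 2 * pi * (besselJ m z ^+ 2
        * cos (m%:~R * (pi / 2 - theta - (pi / 2 - theta')) + d)))
      + window_sum N (fun m => 2 * pi * (derive1 (besselJ m) z ^+ 2
        * cos (m%:~R * (pi / 2 - theta - (pi / 2 - theta')) + d))))).
    by apply: cvgMr; exact: cvgD w dw.
  apply/funext => N; rewrite -window_sumD -window_sumZ.
  apply: eq_window_sum => m; rewrite /tau2 -/z.
  rewrite (_ : m%:~R * (pi / 2 - theta - (pi / 2 - theta')) =
    - (m%:~R * (theta - theta'))); last by ring.
  by rewrite /z; ring.
split.
  rewrite (_ : (fun N => _) = fun N => window_sum N (fun m => tau2 kappa h m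
      * cos (- (m%:~R * (theta - theta')) + 0))); first exact: L.
  by apply/funext => N; apply: eq_window_sum => m; rewrite /a /= addr0 mul0r subr0.
rewrite (_ : (fun N => _) = fun N => window_sum N (fun m => tau2 kappa h m
    * cos (- (m%:~R * (theta - theta')) - pi / 2))); first exact: L.
apply/funext => N; apply: eq_window_sum => m.
by rewrite /a /= mul0r addr0 cosB cos_pihalf sin_pihalf mulr0 add0r mulr1.
Qed.

(** The majorant needed for unconditional convergence is [tau_m^2] itself: its window
    sums converge, being those of the trace norm of one plane wave. *)
Lemma cvg_trace_csum kappa h x0 theta theta' : 0 < kappa -> 0 < h ->
  csum_partial setT (fun m => (tau2 kappa h m)%:C
      * expi (- (m%:~R * (theta - theta')))) A
    @[A --> @summability.totally int] -->
  (trace_ip kappa x0 h (plane_wave kappa x0 theta)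
    (plane_wave kappa x0 theta') : R[i]^o).
Proof.
move=> kappa0 h0.
have [ax ay] := cvg_trace_sum kappa h x0 theta theta' kappa0 h0.
have [bl _] := cvg_trace_sum kappa h x0 0 0 kappa0 h0.
rewrite [X in _ --> X]complexE.
have -> (z : R[i]) : (complex.Re z)%:C + 'i%C * (complex.Im z)%:C
  = complex.Re z +i* complex.Im z by rewrite -complexE; case: z.
apply: (cvg_csum_partial _ _ _ _ _ _ bl ax ay) => m.
have tau0 : 0 <= tau2 kappa h m.
  rewrite /tau2 mulr_ge0 ?addr_ge0 ?sqr_ge0//.
  by rewrite !mulr_ge0// ?pi_ge0 ?ltW.
rewrite normrM ger0_norm ?ler0c//.
rewrite (_ : `|expi _| = 1) ?mulr1; last first.
  by rewrite normc_def /= cos2Dsin2 sqrtr1.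
by rewrite lecR subr0 mulr0 oppr0 /expi /= cos0 sin0 mulr1 mul0r subr0.
Qed.
End PlaneWaveTrace.

(** * Roots of unity and circulant matrices *)

Section Expi.
Context {R : realType}.
Implicit Types (x y : R) (n m : int).

Lemma expiD x y : expi (x + y) = expi x * expi y.
Proof.
by apply/eqP; rewrite eq_complex /= cosD sinD [sin x * _ + _]addrC !eqxx.
Qed.

Lemma expi0 : expi 0 = 1 :> R[i].
Proof. by rewrite /expi cos0 sin0. Qed.

Lemma expiD2piz x n : expi (x + n%:~R * (2 * pi)) = expi x.
Proof. by rewrite /expi cosD2piz sinD2piz. Qed.

Lemma expiMn x k : expi (k%:R * x) = expi x ^+ k.
Proof.
elim: k => [|k IH]; first by rewrite mul0r expi0.
by rewrite exprS -IH -expiD -natr1 mulrDl mul1r addrC.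
Qed.

Lemma expi_neq1 x : 0 < x < 2 * pi -> expi x != 1.
Proof.
move=> /andP[x0 x2]; apply/eqP => /(congr1 (@complex.Re R)) /= cx.
have sx : 0 < sin (x / 2).
  apply: sin_gt0_pi; rewrite divr_gt0//= ltr_pdivrMr//.
  by rewrite mulrC.
move: cx; rewrite [x]splitr cosD -!expr2 cos2sin2 => h.
have : sin (x / 2) ^+ 2 > 0 by rewrite exprn_gt0.
lra.
Qed.
End Expi.

Section RootsOfUnity.
Context {R : realType} (q : nat) (q_gt0 : (0 < q)%N).
Implicit Types (n m : int).

Definition rootq n : R[i] := expi (n%:~R * (2 * pi / q%:R)).

Let qR0 : q%:R != 0 :> R. Proof. by rewrite pnatr_eq0 -lt0n. Qed.

Lemma rootqD n m : rootq (n + m) = rootq n * rootq m.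
Proof. by rewrite /rootq intrD mulrDl expiD. Qed.

Lemma rootq_mulq n : rootq (n * q%:Z) = 1.
Proof.
rewrite /rootq (_ : _ * _ = 0 + n%:~R * (2 * pi)) ?expiD2piz ?expi0//.
by rewrite intrM -[q%:Z%:~R]/(q%:R); field.
Qed.

Lemma rootq_mod n m : (n = m %[mod q%:Z])%Z -> rootq n = rootq m.
Proof.
move=> /eqP; rewrite eqz_mod_dvd => /dvdzP[k nm].
by rewrite -[n](subrK m) nm rootqD rootq_mulq mul1r.
Qed.

Lemma rootqX n (k : nat) : rootq n ^+ k = rootq (k%:Z * n).
Proof. by rewrite /rootq -expiMn intrM mulrA. Qed.

Lemma rootq_neq1 n : ~~ (q%:Z %| n)%Z -> rootq n != 1.
Proof.
move=> qn; rewrite (rootq_mod n (n %% q%:Z)%Z) ?modz_mod//.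
have qZ : q%:Z != 0 by rewrite -lt0n.
have r0 : (0 < n %% q%:Z)%Z.
  rewrite lt_neqAle modz_ge0// andbT eq_sym; apply: contraNneq qn => r0.
  by apply/dvdz_mod0P.
have rq : (n %% q%:Z < q%:Z)%Z by rewrite ltz_pmod.
apply: expi_neq1; rewrite mulr_gt0 ?ltr0z ?divr_gt0 ?mulr_gt0 ?pi_gt0 ?ltr0n//=.
rewrite mulrA ltr_pdivrMr ?ltr0n// mulrC ltr_pM2l ?mulr_gt0 ?pi_gt0//.
by rewrite -[q%:R]/(q%:Z%:~R) ltr_int.
Qed.

Lemma sum_rootq n :
  \sum_(k < q) rootq (k%:Z * n) = if (q%:Z %| n)%Z then q%:R else 0.
Proof.
case: ifPn => qn.
  rewrite (eq_bigr (fun=> 1)) ?sumr_const ?card_ord// => k _.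
  have [d ->] := dvdzP qn.
  by rewrite mulrA rootq_mulq.
have := subrX1 (rootq n) q.
rewrite rootqX mulrC rootq_mulq subrr => /esym/eqP.
rewrite mulf_eq0 subr_eq0 (negbTE (rootq_neq1 _ qn)) => /eqP S0.
by rewrite -[RHS]S0; apply: eq_bigr => k _; rewrite rootqX.
Qed.

(** A residue class is filtered by a discrete Fourier transform.  On finite partial
    sums this is an identity, so convergence over a residue class follows from
    convergence of the full twisted sums. *)
Lemma csum_partial_residue (c : int -> R[i]) (s : nat) (A : {fset int}) :
  csum_partial [set m : int | (m = - s%:Z %[mod q%:Z])%Z] c A =
  q%:R^-1 * \sum_(k < q) rootq (k%:Z * s%:Z) *
    csum_partial setT (fun m => c m * rootq (k%:Z * m)) A.
Proof.
have qC : q%:R != 0 :> R[i] by rewrite pnatr_eq0 -lt0n.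
rewrite /csum_partial big_mkcond /=.
transitivity (\sum_(m <- A) q%:R^-1 * (c m * \sum_(k < q) rootq (k%:Z * (m + s%:Z)))).
  apply: eq_bigr => m _; rewrite sum_rootq.
  have -> : (q%:Z %| m + s%:Z)%Z = (m == - s%:Z %[mod q%:Z])%Z.
    by rewrite eqz_mod_dvd opprK.
  case: ifPn => [|] /=.
    by rewrite inE /= => /eqP ->; rewrite mulrC mulfK.
  by rewrite notin_setE /= => /eqP /negbTE ->; rewrite !mulr0.
rewrite -mulr_sumr; congr (_ * _).
rewrite [RHS](eq_bigr (fun k : 'I_q => \sum_(m <- A)
    rootq (k%:Z * s%:Z) * (c m * rootq (k%:Z * m)))); last first.
  by move=> k _; rewrite mulr_sumr; apply: eq_bigl => m; rewrite in_setT.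
rewrite exchange_big /=; apply: eq_bigr => m _; rewrite mulr_sumr.
by apply: eq_bigr => k _; rewrite mulrDr rootqD; ring.
Qed.

Lemma cvg_csum_residue (c : int -> R[i]) (g : nat -> R[i]) (s : nat) :
  (forall k, csum_partial setT (fun m => c m * rootq (k%:Z * m)) A
     @[A --> @summability.totally int] --> (g k : R[i]^o)) ->
  csum_partial [set m : int | (m = - s%:Z %[mod q%:Z])%Z] c A
    @[A --> @summability.totally int] -->
  (q%:R^-1 * \sum_(k < q) rootq (k%:Z * s%:Z) * g k : R[i]^o).
Proof.
move=> gk.
rewrite (_ : (fun A => _) = fun A => q%:R^-1 * \sum_(k < q) rootq (k%:Z * s%:Z) *
    csum_partial setT (fun m => c m * rootq (k%:Z * m)) A); last first.
  by apply/funext => A; exact: csum_partial_residue.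
apply: cvgMr.
apply: cvg_big => [|k _]; first exact: add_continuous.
by apply: cvgMr; exact: gk.
Qed.

(** The Fourier matrix [V] diagonalises every circulant matrix; it is invertible by
    orthogonality of the characters of Z/q. *)
Lemma circulant_eigenvalues (c : nat -> R[i]) (M : 'M[R[i]]_q) :
  (forall j l : 'I_q, M j l = c ((l + (q - j)) %% q)%N) ->
  eigenvalues_with_mult M
    [seq \sum_(k < q) rootq (k%:Z * s%:Z) * c k | s : 'I_q <- enum 'I_q].
Proof.
move=> Mc; pose lam (s : 'I_q) := \sum_(k < q) rootq (k%:Z * s%:Z) * c k.
rewrite /eigenvalues_with_mult big_map big_enum /= -/lam.
pose V : 'M[R[i]]_q := \matrix_(l, s) rootq (l%:Z * s%:Z).
pose W : 'M[R[i]]_q := \matrix_(s, l) rootq (- (s%:Z * l%:Z)).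
have VW : V *m W = q%:R%:M.
  apply/matrixP => l l'; rewrite !mxE.
  under eq_bigr => s _ do
    rewrite !mxE -rootqD mulrC -mulrBr.
  rewrite sum_rootq -eqz_mod_dvd !modz_small ?ltz_nat ?ltn_ord//.
  by rewrite eqz_nat val_eqE; case: eqP.
have V0 : \det V != 0.
  have : \det (V *m W) != 0 by rewrite VW det_scalar expf_neq0 ?pnatr_eq0 -?lt0n.
  by rewrite det_mulmx mulf_eq0 negb_or => /andP[].
have MV : M *m V = V *m diag_mx (\row_s lam s).
  apply/matrixP => j s; rewrite mul_mx_diag !mxE /lam mulr_sumr.
  pose sh (k : 'I_q) : 'I_q := Ordinal (ltn_pmod (k + j) q_gt0).
  have shK : cancel sh (fun l : 'I_q => Ordinal (ltn_pmod (l + (q - j)) q_gt0)).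
    move=> k; apply: val_inj => /=.
    by rewrite modnDml -addnA subnKC ?modnDr ?modn_small// ltnW.
  rewrite (reindex_inj (can_inj shK)) /=; apply: eq_bigr => k _.
  have := congr1 val (shK k); rewrite !mxE Mc /= => ->.
  rewrite mulrA -rootqD mulrC; congr (_ * _); apply: rootq_mod.
  rewrite -mulrDl -modz_nat modzMml; congr (_ * _ %% _)%Z.
  by rewrite PoszD addrC.
have CV : char_poly_mx M *m map_mx polyC V =
          map_mx polyC V *m diag_mx (\row_s ('X - (lam s)%:P)).
  rewrite /char_poly_mx mulmxBl -map_mxM MV.
  rewrite map_mxM map_diag_mx mul_scalar_mx -mul_mx_scalar -mulmxBr.
  congr (_ *m _); apply/matrixP => i j; rewrite !mxE.
  by case: eqP => _; rewrite ?mulr1n ?mulr0n ?subr0.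
have := congr1 determinant CV.
have V0P : (\det V)%:P != 0 by rewrite polyC_eq0.
rewrite !det_mulmx det_diag det_map_mx /= [RHS]mulrC => /(mulIf V0P) MP.
by rewrite /char_poly MP; apply: eq_bigr => s _; rewrite mxE.
Qed.
End RootsOfUnity.

(** * The Gram matrix of equispaced plane waves *)

(** The inner product of two plane waves depends only on the difference of the
    angles modulo [2 pi], so it is an entry of the first row; the twisted sums of
    [tau_m^2] by q-th roots of unity converge to the entries of that row. *)
Lemma gram_PW_circulant (R : realType) (kappa h : R) (x0 : 'rV[R]_2) (q : nat) :
  0 < kappa -> 0 < h -> (0 < q)%N -> exists c : nat -> R[i],
  (forall j l : 'I_q, gram_PW kappa x0 h q j l = c ((l + (q - j)) %% q)%N) /\
  (forall k, csum_partial setT (fun m => (tau2 kappa h m)%:C * rootq q (k%:Z * m)) A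
     @[A --> @summability.totally int] --> (c k : R[i]^o)).
Proof.
move=> kappa0 h0 q0; have qR0 : q%:R != 0 :> R by rewrite pnatr_eq0 -lt0n.
pose c k : R[i] := trace_ip kappa x0 h (plane_wave kappa x0 0)
  (plane_wave kappa x0 (2 * pi * k%:R / q%:R)).
have cC k : csum_partial setT
    (fun m => (tau2 kappa h m)%:C * rootq q (k%:Z * m)) A
     @[A --> @summability.totally int] --> (c k : R[i]^o).
  have := cvg_trace_csum kappa h x0 0 (2 * pi * k%:R / q%:R) kappa0 h0.
  rewrite (_ : (fun m => _) = fun m => (tau2 kappa h m)%:C * rootq q (k%:Z * m)).
    exact.
  apply/funext => m; congr (_ * expi _).
  by rewrite intrM -[k%:Z%:~R]/(k%:R); field.
exists c; split=> // j l; rewrite mxE.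
have := cvg_trace_csum kappa h x0 (2 * pi * j%:R / q%:R) (2 * pi * l%:R / q%:R)
  kappa0 h0.
rewrite (_ : (fun m => _) = fun m => (tau2 kappa h m)%:C *
    rootq q (((l + (q - j)) %% q)%N%:Z * m)).
  have RiH := @norm_hausdorff _ R[i]^o.
  by move=> G; rewrite -(cvg_lim RiH G); exact: (cvg_lim RiH (cC _)).
apply/funext => m; congr (_ * _).
transitivity (rootq q ((l%:Z - j%:Z) * m) : R[i]).
  rewrite /rootq; congr expi.
  by rewrite intrM intrB -[j%:Z%:~R]/(j%:R) -[l%:Z%:~R]/(l%:R); field.
apply: rootq_mod => //; apply/eqP; rewrite eqz_mod_dvd -mulrBl dvdz_mulr//.
have jq := ltn_ord j; have := divn_eq (l + (q - j)) q.
set d := (_ %/ q)%N; set k := (_ %% q)%N => lE.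
by apply/dvdzP; exists (d%:Z - 1); rewrite mulrBl mul1r; lia.
Qed.

Theorem theorem3p4 (R : realType) (kappa h : R) (x0 : 'rV[R]_2)
    (kappa_gt0 : 0 < kappa) (h_gt0 : 0 < h) :
  (forall theta_j theta_l : R,
     let a (m : int) : R[i] :=
       (tau2 kappa h m)%:C * expi (- (m%:~R * (theta_j - theta_l))) in
     csummable setT a /\
     trace_ip kappa x0 h
       (plane_wave kappa x0 theta_j) (plane_wave kappa x0 theta_l)
     = csum setT a)
  /\
  (forall q : nat, (1 <= q)%N ->
     let D (s : 'I_q) : set int := [set m : int | (m = - s%:Z %[mod q%:Z])%Z] in
     let lambda (s : 'I_q) : R[i] :=
       q%:R * csum (D s) (fun m => (tau2 kappa h m)%:C) in
     [/\ circulant (gram_PW kappa x0 h q),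
         forall s : 'I_q, csummable (D s) (fun m => (tau2 kappa h m)%:C)
       & eigenvalues_with_mult (gram_PW kappa x0 h q)
           [seq lambda s | s <- enum 'I_q]]).
Proof.
have RiH := @norm_hausdorff _ R[i]^o.
split=> [theta_j theta_l a|q q0 D lambda].
  have aT := cvg_trace_csum kappa h x0 theta_j theta_l kappa_gt0 h_gt0.
  split; first by apply/cvg_ex; eexists; exact: aT.
  by rewrite /csum (cvg_lim RiH aT).
have [c [cE cC]] := gram_PW_circulant R kappa h x0 q kappa_gt0 h_gt0 q0.
have DC (s : 'I_q) := cvg_csum_residue q q0 (fun m => (tau2 kappa h m)%:C) c s cC.
split; first by exists c.
  by move=> s; apply/cvg_ex; eexists; exact: DC.
have lamE (s : 'I_q) : lambda s = \sum_(k < q) rootq q (k%:Z * s%:Z) * c k.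
  rewrite /lambda /csum (cvg_lim RiH (DC s)).
  by rewrite mulVKf// pnatr_eq0 -lt0n.
by rewrite (eq_map lamE); exact: circulant_eigenvalues.
Qed.
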